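(* Let $N>2$. Let $$Q_N=\{[z_1,\ldots,z_N]\in P^{N-1}(\mathbb{C})\mid z_1^2+\cdots+z_N^2=0\}.$$ The set $$Q_N\cap\bigcup_{D}P^{N-1}\big(\mathbb{Q}(\sqrt{-D})\big),$$ where $D$ runs over all square free positive integers, is identified with the set of oriented similarity classes of $2$-dimensional crystallographic tight frames of size $N$. That is, the map sending a crystallographic tight frame $\{{\bf v}_i\}_{i=1}^N$ in $\mathbb{R}^2$, ${\bf v}_i={}^t(a_i,b_i)$, to the point $[a_1+b_1\sqrt{-1},\ldots,a_N+b_N\sqrt{-1}]$ induces a bijection from the set of oriented similarity classes onto this set.
   Context: A frame of size $N$ in $\mathbb{R}^d$ is a sequence $\mathcal{S}=\{{\bf v}_i\}_{i=1}^N$ of vectors spanning $\mathbb{R}^d$ (zero or parallel vectors are allowed). It is tight if there is $\alpha>0$ with $\sum_{i=1}^N\langle{\bf x},{\bf v}_i\rangle{\bf v}_i=\alpha{\bf x}$ for all ${\bf x}\in\mathbb{R}^d$. It is crystallographic if the additive group generated by ${\bf v}_1,\ldots,{\bf v}_N$ is a lattice in $\mathbb{R}^d$. Two frames $\{{\bf u}_i\}_{i=1}^N$, $\{{\bf v}_i\}_{i=1}^N$ in $\mathbb{R}^2$ are in the same oriented similarity class if there exist $\lambda>0$ and $U\in SO(2)$ with ${\bf u}_i=\lambda U{\bf v}_i$ for all $i$. For a subfield $K\subset\mathbb{C}$, $P^{N-1}(K)\subset P^{N-1}(\mathbb{C})$ denotes the set of points admitting homogeneous coordinates in $K$. *)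

(* Defs.v *)
From HB Require Import structures.
From mathcomp Require Import all_boot all_order all_algebra.
From mathcomp Require Import all_classical all_reals.
From mathcomp Require Import complex.

Set Implicit Arguments.
Unset Strict Implicit.
Unset Printing Implicit Defensive.

Import Order.TTheory GRing.Theory Num.Theory.

Local Open Scope classical_set_scope.
Local Open Scope ring_scope.

Section Frames.
Variables (R : realType) (d N : nat).
Implicit Types (v : N.-tuple 'cV[R]_d).

Definition dotp (x y : 'cV[R]_d) : R := \sum_(k < d) x k 0 * y k 0.

Definition is_frame v : Prop := <<v>>%VS = fullv.

Definition tight v : Prop :=
  exists2 alpha : R, 0 < alpha &
    forall x : 'cV[R]_d,
      \sum_(i < N) dotp x (tnth v i) *: tnth v i = alpha *: x.

Definition generated_group v : set 'cV[R]_d :=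
  [set x | forall S : {pred 'cV[R]_d},
    zmod_closed S -> {subset v <= S} -> x \in S].

(* The rank is full: a lattice is the Z-span of an R-basis of the space. *)
Definition is_lattice (L : set 'cV[R]_d) : Prop :=
  exists2 b : d.-tuple 'cV[R]_d,
    basis_of fullv b & L = [set x | inIntSpan b x].

Definition crystallographic v : Prop := is_lattice (generated_group v).

Definition crystallographic_tight_frame : set (N.-tuple 'cV[R]_d) :=
  [set v | [/\ is_frame v, tight v & crystallographic v]].

End Frames.

Arguments crystallographic_tight_frame R d N : clear implicits.

Section PlaneFrames.
Variables (R : realType) (N : nat).
Implicit Types (u v : N.-tuple 'cV[R]_2).

Definition SO2 : set 'M[R]_2 := [set U | U^T *m U = 1%:M /\ \det U = 1].

Definition oriented_similar u v : Prop :=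
  exists lambda : R, exists U : 'M[R]_2,
    [/\ 0 < lambda, SO2 U &
        forall i : 'I_N, tnth u i = lambda *: (U *m tnth v i)].

Definition similarity_class v : set (N.-tuple 'cV[R]_2) :=
  [set u | crystallographic_tight_frame R 2 N u /\ oriented_similar u v].

Definition similarity_classes : set (set (N.-tuple 'cV[R]_2)) :=
  [set similarity_class v | v in crystallographic_tight_frame R 2 N].

Definition complex_coords v : 'rV[R[i]]_N :=
  \row_(i < N) (tnth v i 0 0 +i* tnth v i 1 0)%C.

End PlaneFrames.

Arguments similarity_classes R N : clear implicits.

Section Projective.
Variables (R : realType) (N : nat).

(* A point of P^{N-1}(C) is a line of C^N; [hpoint z] is [z_1, ..., z_N], and
   it is a point of the projective space only when z != 0. *)
Definition hpoint (z : 'rV[R[i]]_N) : {vspace 'rV[R[i]]_N} := <[z]>%VS.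

Definition proj_over (K : set R[i]) : set {vspace 'rV[R[i]]_N} :=
  [set hpoint z | z in [set z : 'rV[R[i]]_N | z != 0 /\ forall i, K (z 0 i)]].

Definition quadric : set {vspace 'rV[R[i]]_N} :=
  [set hpoint z | z in
     [set z : 'rV[R[i]]_N | z != 0 /\ \sum_(i < N) z 0 i ^+ 2 = 0]].

End Projective.

Arguments proj_over R N K : clear implicits.
Arguments quadric R N : clear implicits.

(* Smallest subfield of C containing a; it contains Q since C has
   characteristic 0. *)
Definition adjoinQ (R : realType) (a : R[i]) : set R[i] :=
  [set z | forall S : {pred R[i]}, divring_closed S -> a \in S -> z \in S].

Definition squarefree (D : nat) : Prop :=
  forall m : nat, (m ^ 2 %| D)%N -> m = 1%N.

Definition imag_quadratic_points (R : realType) (N : nat) :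
    set {vspace 'rV[R[i]]_N} :=
  \bigcup_(D in [set D : nat | (0 < D)%N /\ squarefree D])
    proj_over R N (adjoinQ (sqrtC (- D%:R : R[i]))).

Arguments imag_quadratic_points R N : clear implicits.

(* Main.v *)
Require Import Defs.
From HB Require Import structures.
From mathcomp Require Import all_boot all_order all_algebra.
From mathcomp Require Import all_classical all_reals.
From mathcomp Require Import complex.
From mathcomp Require Import ring lra.

Import Order.TTheory GRing.Theory Num.Theory.

Local Open Scope classical_set_scope.
Local Open Scope ring_scope.

(** Identify [R^2] with the complex line, so that a sequence of vectors becomes
    a vector [z] of complex coordinates. Rotations and positive dilations
    together are then the multiplications by nonzero complex numbers
    ([SO2_mul], [mul_SO2]): two sequences are similar exactly when their
    coordinates are proportional ([oriented_similarP]), which makes the map to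
    projective points well defined and injective.

    The real and imaginary parts of [sum z_i^2] are [sum a_i^2 - sum b_i^2] and
    [2 sum a_i b_i], so that, for [z != 0], the quadric is the tightness
    condition ([tight_coords], [coords_tight]); a tight sequence
    spans the plane. What is left is to match lattices with imaginary quadratic
    fields.

    If the [z_i] generate a lattice with basis [w, w tau], then
    [z_i = w (m_i + n_i tau)] with [m_i], [n_i] integers, and [sum z_i^2 = 0]
    becomes a quadratic equation for [tau] with integer coefficients. As [tau]
    is not real, its discriminant is negative, so [tau] is in some
    [Q(sqrt(-D))] ([quadratic_adjoinQ]), and so are the coordinates [z_i / w] of
    the same projective point.

    Conversely, if all [z_i] are in [Q(sqrt(-D))], clearing denominators puts
    them in a group generated by two elements [1/k] and [sqrt(-D)/l]. A subgroup
    of a group with two generators has two generators ([int_span_sub], from the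
    Smith normal form), and here these span the plane because the frame does:
    they are a basis of it ([imag_quadratic_crystallographic]). *)

Set Implicit Arguments.
Unset Strict Implicit.

(** * The plane as the complex line *)

Lemma sum_sqr_eq0 (F : realDomainType) (I : finType) (f : I -> F) :
  \sum_i f i ^+ 2 = 0 -> forall i, f i = 0.
Proof.
move=> f0 i; have nn j : true -> 0 <= f j ^+ 2 by rewrite sqr_ge0.
by apply/eqP; rewrite -sqrf_eq0 (psumr_eq0P nn f0).
Qed.

Section PlaneAsComplexLine.
Variable R : realType.
Implicit Types (x y : 'cV[R]_2) (z c : R[i]).

Definition complex_of_vec x : R[i] := (x 0 0 +i* x 1 0)%C.

Definition vec_of_complex z : 'cV[R]_2 :=
  \col_k (if k == 0 then complex.Re z else complex.Im z).

Lemma complex_of_vecK : cancel complex_of_vec vec_of_complex.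
Proof.
move=> x; apply/matrixP => i j; rewrite !mxE (ord1 j).
by case: i => [[|[|//]] ilt] /=; congr (x _ _); apply: val_inj.
Qed.

Lemma vec_of_complexK : cancel vec_of_complex complex_of_vec.
Proof. by case=> a b; rewrite /complex_of_vec !mxE. Qed.

Lemma complex_of_vec_is_additive : zmod_morphism complex_of_vec.
Proof. by move=> x y; rewrite /complex_of_vec !mxE; simpc. Qed.

HB.instance Definition _ := GRing.isZmodMorphism.Build 'cV[R]_2 R[i]
  complex_of_vec complex_of_vec_is_additive.

Lemma complex_of_vecZ (r : R) x :
  complex_of_vec (r *: x) = r%:C%C * complex_of_vec x.
Proof. by rewrite /complex_of_vec !mxE; simpc. Qed.

Lemma complex_of_vec_int_comb x y (m n : int) :
  complex_of_vec (x *~ m + y *~ n) =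
  m%:~R * complex_of_vec x + n%:~R * complex_of_vec y.
Proof. by rewrite !mulrzl -!raddfMz -raddfD. Qed.

Lemma complex_of_vec_eq0 x : (complex_of_vec x == 0) = (x == 0).
Proof.
by rewrite -(inj_eq (can_inj complex_of_vecK)) raddf0.
Qed.

(** Unit columns and unit determinant force the second column to be the first
    one turned by a quarter:
    [(a - d)^2 + (b + c)^2 = (a^2 + c^2) + (b^2 + d^2) - 2 (a d - b c) = 0].
    The complex factor is then [a + i c]. *)
Lemma SO2_mul (U : 'M[R]_2) : SO2 U ->
  exists2 c : R[i], c != 0 &
    forall x, complex_of_vec (U *m x) = c * complex_of_vec x.
Proof.
case=> UtU; rewrite (expand_det_row _ 0) !big_ord_recl big_ord0 /cofactor.
rewrite !det_mx11 !mxE /= => detU.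
have := congr1 (fun A : 'M_2 => A 0 0) UtU.
have := congr1 (fun A : 'M_2 => A 1 1) UtU.
rewrite !mxE !big_ord_recl !big_ord0 !mxE /= !addr0.
move: detU; rewrite !addr0.
have -> : lift 0 0 = 1 :> 'I_2 by apply: val_inj.
have -> : lift 1 0 = 0 :> 'I_2 by apply: val_inj.
set a : R := U 0 0; set b : R := U 0 1; set c : R := U 1 0; set d : R := U 1 1.
rewrite /bump /= expr0 addn0 expr1 => det1 col1 col0.
have /eqP : (a - d) ^+ 2 + (b + c) ^+ 2 = 0 by nra.
rewrite paddr_eq0 ?sqr_ge0 // !sqrf_eq0 => /andP[/eqP ad /eqP bc].
exists (a +i* c)%C.
  apply/negP; rewrite eq_complex /= => /andP[/eqP a0 /eqP c0].
  by move/eqP: col0; rewrite a0 c0 !mul0r addr0 eq_sym oner_eq0.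
move=> x; rewrite /complex_of_vec !mxE !big_ord_recl !big_ord0.
have -> : lift 0 0 = 1 :> 'I_2 by apply: val_inj.
rewrite -/a -/b -/c -/d; simpc; apply/eqP; rewrite eq_complex /=.
by apply/andP; split; apply/eqP; [have -> : b = - c by lra | have -> : d = a by lra]; ring.
Qed.

(** The polar decomposition [c = |c| (c / |c|)]. *)
Lemma mul_SO2 c : c != 0 ->
  exists lambda : R, exists U : 'M[R]_2, [/\ 0 < lambda, SO2 U &
    forall x, complex_of_vec (lambda *: (U *m x)) = c * complex_of_vec x].
Proof.
case: c => p q; rewrite eq_complex /= negb_and => pq0.
have n_gt0 : 0 < p ^+ 2 + q ^+ 2.
  by rewrite lt_def addr_ge0 ?sqr_ge0 // andbT paddr_eq0 ?sqr_ge0 // !sqrf_eq0 negb_and.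
set l := Num.sqrt (p ^+ 2 + q ^+ 2).
have l_gt0 : 0 < l by rewrite sqrtr_gt0.
have ll : l ^+ 2 = p ^+ 2 + q ^+ 2 by rewrite sqr_sqrtr // ltW.
pose U : 'M[R]_2 := \matrix_(i, j)
  (if i == j then p / l else if i == 0 then - q / l else q / l).
have l0 : l != 0 by rewrite gt_eqF.
have E1 : p / l * (p / l) + q / l * (q / l) = 1.
  have -> : p / l * (p / l) + q / l * (q / l) = (p ^+ 2 + q ^+ 2) / l ^+ 2 by field.
  by rewrite -ll divff // expf_neq0.
exists l, U; split=> //.
- split.
    apply/matrixP => i j; rewrite !mxE !big_ord_recl big_ord0 !mxE.
    by case: i => [[|[|//]] ?]; case: j => [[|[|//]] ?] /=;
      first [ring | rewrite -[RHS]E1; ring].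
  rewrite (expand_det_row _ 0) !big_ord_recl big_ord0 /cofactor.
  by rewrite !det_mx11 !mxE /= /bump /= -[RHS]E1; ring.
move=> x; rewrite /complex_of_vec !mxE !big_ord_recl !big_ord0 !mxE /=.
have -> : lift 0 0 = 1 :> 'I_2 by apply: val_inj.
by simpc; apply/eqP; rewrite eq_complex /=; apply/andP; split; apply/eqP; field.
Qed.

End PlaneAsComplexLine.

(** * Similarity and tightness in complex coordinates *)

Section Frames.
Variables (R : realType) (N : nat).
Implicit Types (u v : N.-tuple 'cV[R]_2) (z : 'rV[R[i]]_N).
Local Notation cplx := (@complex_of_vec R).

Definition vecs_of_coords z : N.-tuple 'cV[R]_2 :=
  [tuple vec_of_complex (z 0 i) | i < N].

Lemma complex_coordsE v i : complex_coords v 0 i = cplx (tnth v i).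
Proof. by rewrite mxE. Qed.

Lemma vecs_of_coordsK z : complex_coords (vecs_of_coords z) = z.
Proof.
by apply/rowP => i; rewrite complex_coordsE tnth_mktuple vec_of_complexK.
Qed.

Lemma oriented_similarP u v : oriented_similar u v <->
  exists2 c : R[i], c != 0 & complex_coords u = c *: complex_coords v.
Proof.
split=> [[l [U [l_gt0 /SO2_mul[c c0 cE] uE]]]|[c /mul_SO2[l [U [l_gt0 sU UE]]] uE]].
  exists (l%:C%C * c).
    by rewrite mulf_neq0 // eq_complex /= eqxx andbT gt_eqF.
  apply/rowP => i; rewrite [RHS]mxE !complex_coordsE uE complex_of_vecZ cE.
  by rewrite mulrA.
exists l, U; split=> // i; apply: (can_inj (@complex_of_vecK R)).
by rewrite UE -!complex_coordsE uE mxE.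
Qed.

Lemma hpoint_eq (z w : 'rV[R[i]]_N) : z != 0 ->
  hpoint z = hpoint w <-> exists2 c : R[i], c != 0 & z = c *: w.
Proof.
move=> z0; split=> [zw|[c c0 ->]].
  have /vlineP[c zE] : z \in <[w]>%VS by rewrite -/(hpoint w) -zw memv_line.
  by exists c => //; apply: contraNneq z0 => c0; rewrite zE c0 scale0r.
apply/eqP; rewrite eqEsubv; apply/andP; split; rewrite -memvE.
  by apply/vlineP; exists c.
by apply/vlineP; exists c^-1; rewrite scalerA mulVf // scale1r.
Qed.

Lemma oriented_similar_refl v : oriented_similar v v.
Proof. by apply/oriented_similarP; exists 1; rewrite ?oner_eq0 ?scale1r. Qed.

Lemma oriented_similar_sym u v : oriented_similar u v -> oriented_similar v u.
Proof.
move=> /oriented_similarP[c c0 uE]; apply/oriented_similarP.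
by exists c^-1; rewrite ?invr_eq0 // uE scalerA mulVf // scale1r.
Qed.

Lemma oriented_similar_trans u v w :
  oriented_similar u v -> oriented_similar v w -> oriented_similar u w.
Proof.
move=> /oriented_similarP[c c0 uE] /oriented_similarP[c' c'0 vE].
apply/oriented_similarP; exists (c * c'); first exact: mulf_neq0.
by rewrite uE vE scalerA.
Qed.

Lemma dotp2E (x y : 'cV[R]_2) : dotp x y = x 0 0 * y 0 0 + x 1 0 * y 1 0.
Proof.
rewrite /dotp !big_ord_recl big_ord0 addr0.
by have -> : lift 0 0 = 1 :> 'I_2 by apply: val_inj.
Qed.

Lemma sum_complex (I : finType) (f g : I -> R) :
  \sum_i (f i +i* g i)%C = ((\sum_i f i) +i* (\sum_i g i))%C.
Proof.
by elim/big_rec3: _ => // i a b _ _ ->; simpc.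
Qed.

Lemma sum_sqr_coords v : \sum_i complex_coords v 0 i ^+ 2 =
  ((\sum_i tnth v i 0 0 ^+ 2 - \sum_i tnth v i 1 0 ^+ 2) +i*
   ((\sum_i tnth v i 0 0 * tnth v i 1 0) *+ 2))%C.
Proof.
rewrite -sumrB -sumrMnl -sum_complex; apply: eq_bigr => i _.
rewrite complex_coordsE expr2 /complex_of_vec; simpc.
by rewrite -!expr2 mulr2n [tnth v i 1 0 * _]mulrC.
Qed.

(** Testing tightness on the canonical basis gives the Gram relations
    [sum a_i^2 = sum b_i^2 = alpha] and [sum a_i b_i = 0]. *)
Lemma tight_coords v : tight v ->
  complex_coords v != 0 /\ \sum_i complex_coords v 0 i ^+ 2 = 0.
Proof.
case=> a a_gt0 tv; rewrite sum_sqr_coords.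
have E k l : \sum_i tnth v i k 0 * tnth v i l 0 = if k == l then a else 0.
  have /(congr1 (fun x : 'cV_2 => x l 0)) := tv (delta_mx k 0).
  rewrite summxE !mxE eqxx andbT eq_sym.
  under eq_bigr => i _.
    have -> : (dotp (delta_mx k 0) (tnth v i) *: tnth v i) l 0 =
       tnth v i k 0 * tnth v i l 0.
      rewrite mxE /dotp (bigD1 k) //= big1 ?addr0 => [|j jk].
        by rewrite mxE !eqxx mul1r.
      by rewrite mxE (negPf jk) mul0r.
    over.
  by move=> ->; case: eqP; rewrite ?mulr1 ?mulr0.
under eq_bigr => i _ do rewrite expr2.
under [X in _ - X]eq_bigr => i _ do rewrite expr2.
rewrite !E /= subrr mul0rn; split=> //; apply/eqP => z0.
have := E 0 0; rewrite big1 => [/= a0|i _]; first by rewrite -a0 ltxx in a_gt0.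
have := congr1 (fun z => complex.Re (z 0 i)) z0.
by rewrite !mxE /= => ->; rewrite mul0r.
Qed.

(** The tightness constant is [sum a_i^2 = sum b_i^2], which vanishes only with
    [z] itself. *)
Lemma coords_tight v :
  complex_coords v != 0 -> \sum_i complex_coords v 0 i ^+ 2 = 0 -> tight v.
Proof.
rewrite sum_sqr_coords => z0 /eqP; rewrite eq_complex /= subr_eq0 => /andP[].
rewrite mulrn_eq0 /= => /eqP ab /eqP mix.
set a := \sum_i tnth v i 0 0 ^+ 2 in ab.
exists a.
  rewrite lt_def sumr_ge0 ?andbT => [|i _]; last exact: sqr_ge0.
  apply: contra z0 => /eqP a0; apply/eqP/rowP => i; rewrite !mxE.
  by rewrite (sum_sqr_eq0 a0) (sum_sqr_eq0 (etrans (esym ab) a0)).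
move=> x; apply: (can_inj (@complex_of_vecK R)).
rewrite raddf_sum complex_of_vecZ /=.
under eq_bigr => i _.
  have -> : cplx (dotp x (tnth v i) *: tnth v i) =
    ((x 0 0 * tnth v i 0 0 ^+ 2 + x 1 0 * (tnth v i 0 0 * tnth v i 1 0)) +i*
     (x 0 0 * (tnth v i 0 0 * tnth v i 1 0) + x 1 0 * tnth v i 1 0 ^+ 2))%C.
    rewrite complex_of_vecZ dotp2E /complex_of_vec; simpc.
    by apply/eqP; rewrite eq_complex /=; apply/andP; split; apply/eqP; ring.
  over.
rewrite sum_complex !big_split /= -!mulr_sumr mix -ab -/a /complex_of_vec.
by simpc; rewrite ![a * _]mulrC.
Qed.

(** Tightness reconstructs every [x] from its products with the [v_i]. *)
Lemma tight_is_frame v : tight v -> is_frame v.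
Proof.
case=> a a_gt0 tv; apply/eqP; rewrite eqEsubv subvf /=; apply/subvP => x _.
have -> : x = a^-1 *: (a *: x) by rewrite scalerA mulVf ?gt_eqF // scale1r.
rewrite -tv; apply/rpredZ/rpred_sum => i _; apply/rpredZ/memv_span/mem_tnth.
Qed.

End Frames.

(** * Subgroups of finitely generated abelian groups *)

Section IntegerSpan.
Variable V : zmodType.

(** A boolean predicate, so as to be declared a subgroup below and to benefit
    from the closure lemmas on such predicates. *)
Definition int_span m (s : m.-tuple V) : {pred V} :=
  [pred x | `[< inIntSpan s x >]].

Fact int_span_zmod_closed m (s : m.-tuple V) : zmod_closed (int_span s).
Proof.
split=> [|x y /asboolP[a ->] /asboolP[b ->]]; apply/asboolP.
  by exists [ffun=> 0]; rewrite big1 // => i _; rewrite ffunE.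
exists [ffun i => a i - b i]; rewrite -sumrB.
by apply: eq_bigr => i _; rewrite ffunE mulrzBr.
Qed.

HB.instance Definition _ m (s : m.-tuple V) :=
  GRing.isZmodClosed.Build V (int_span s) (int_span_zmod_closed s).

Lemma tnth_int_span m (s : m.-tuple V) i : tnth s i \in int_span s.
Proof.
apply/asboolP; exists [ffun j => (j == i)%:Z].
rewrite (bigD1 i) //= big1 ?addr0 => [|j ji].
  by rewrite ffunE eqxx mulr1z (tnth_nth 0).
by rewrite ffunE (negPf ji).
Qed.

Lemma int_span_min (S : zmodClosed V) m (s : m.-tuple V) :
  (forall i, tnth s i \in S) -> {subset int_span s <= S}.
Proof.
move=> sS x /asboolP[a ->]; apply: rpred_sum => i _.
by rewrite -tnth_nth; apply: rpredMz.
Qed.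

Lemma mul_int_comb m n p (A : 'M[int]_(m, n)) (B : 'M[int]_(n, p))
    (e : 'I_p -> V) i :
  \sum_j e j *~ (A *m B) i j = \sum_k (\sum_j e j *~ B k j) *~ A i k.
Proof.
under eq_bigr => j _ do rewrite mxE mulrz_sumr.
rewrite exchange_big; apply: eq_bigr => k _; rewrite mulrz_suml.
by apply: eq_bigr => j _; rewrite mulrC mulrzA.
Qed.

(** A subgroup of a group with [n] generators has [n] generators: reduce the
    matrix [A] expressing the generators of the subgroup to its Smith form [L D U].
    The invertible factor [L] only replaces these generators by others, and
    all rows of [D U] beyond the [n]-th one vanish. *)
Lemma int_span_sub n N (e : n.-tuple V) (v : N.-tuple V) :
  (forall i, tnth v i \in int_span e) ->
  exists b : n.-tuple V, int_span v =i int_span b.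
Proof.
move=> ve.
have /choice[a aE] : forall i, exists a : int ^ n,
    tnth v i = \sum_(j < n) e`_j *~ a j by move=> i; exact/asboolP/ve.
pose A := \matrix_(i < N, j < n) a i j.
have [L uL [U uU [d _ AE]]] := int_Smith_normal_form A.
set D := \matrix_(i, j) _ in AE.
pose c (l : 'I_N) := \sum_(j < n) e`_j *~ (D *m U) l j.
(* The [c l] with [l < n] give [b]; it is padded with zeros if [N < n]. *)
pose b := [tuple if insub (val j) is Some l then c l else 0 | j < n].
have vc i : tnth v i = \sum_l c l *~ L i l.
  rewrite -mul_int_comb mulmxA -AE aE.
  by apply: eq_bigr => j _; rewrite mxE.
have cv l : c l = \sum_i tnth v i *~ invmx L l i.
  have -> : c l = \sum_(j < n) e`_j *~ (invmx L *m A) l j.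
    by rewrite AE -!mulmxA mulKmx.
  rewrite mul_int_comb; apply: eq_bigr => i _; congr (_ *~ _).
  by rewrite aE; apply: eq_bigr => j _; rewrite mxE.
exists b => x; apply/idP/idP; apply: int_span_min => i.
  rewrite vc; apply: rpred_sum => l _; apply: rpredMz.
  have [ln|nl] := ltnP l n.
    suff <- : tnth b (Ordinal ln) = c l by exact: tnth_int_span.
    by rewrite tnth_mktuple /= valK.
  rewrite /c big1 ?rpred0 // => j _; rewrite mxE big1 ?mulr0z // => k _.
  rewrite mxE; case: eqP => [lk|_]; last by rewrite mulr0n mul0r.
  by move: (ltn_ord k); rewrite -lk ltnNge nl.
rewrite tnth_mktuple; case: insubP => [l _ _|_]; last exact: rpred0.
by rewrite cv; apply: rpred_sum => k _; apply/rpredMz/tnth_int_span.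
Qed.

End IntegerSpan.

(** * Lattices generated by vectors *)

Section Lattices.
Variable R : realType.

Lemma generated_groupE d N (v : N.-tuple 'cV[R]_d) :
  generated_group v = [set x | inIntSpan v x].
Proof.
apply/seteqP; split=> x /=.
  move=> /(_ _ (int_span_zmod_closed v)) xv; apply/asboolP/xv => _ /tnthP[i ->].
  exact: tnth_int_span.
move=> xv S clS vS.
pose S' : zmodClosed 'cV[R]_d := HB.pack S (GRing.isZmodClosed.Build _ S clS).
apply: (@int_span_min _ S' _ v); last exact/asboolP.
by move=> i; apply/vS/mem_tnth.
Qed.

(** [d] vectors whose integer span contains the spanning family [v] span the
    space, so they are a basis of it by dimension. *)
Lemma frame_crystallographic d N (e : d.-tuple 'cV[R]_d)
    (v : N.-tuple 'cV[R]_d) :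
  is_frame v -> (forall i, tnth v i \in int_span e) -> crystallographic v.
Proof.
move=> spanv /int_span_sub[b vb]; exists b.
  rewrite basisEdim size_tuple dimvf /dim /= muln1 leqnn andbT -spanv.
  apply/span_subvP => _ /tnthP[i ->].
  have := tnth_int_span v i; rewrite vb => /asboolP[a ->].
  apply: rpred_sum => j _; rewrite -scaler_int; apply/rpredZ/memv_span.
  by rewrite -tnth_nth mem_tnth.
rewrite generated_groupE; apply/seteqP.
by split=> x /asboolP xv; apply/asboolP; move: xv; rewrite -![`[< _ >]]/(x \in int_span _) vb.
Qed.

(** [tau] is the ratio of the two basis vectors of the lattice; a real ratio
    would make them linearly dependent over [R]. *)
Lemma crystallographic_coords N (v : N.-tuple 'cV[R]_2) :
  crystallographic v -> exists w tau : R[i], [/\ w != 0, complex.Im tau != 0 &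
    forall i, exists m n : int,
      complex_coords v 0 i = w * (m%:~R + n%:~R * tau)].
Proof.
case=> b /basis_free/freeP freeb; rewrite generated_groupE => vb.
pose w1 := complex_of_vec b`_0; pose w2 := complex_of_vec b`_1.
have w1_neq0 : w1 != 0.
  apply/eqP => w10.
  suff /freeb/(_ 0)/eqP : \sum_(i < 2) (i == 0)%:R *: b`_i = 0.
    by rewrite oner_eq0.
  rewrite !big_ord_recl big_ord0 /= scale0r !addr0 scale1r.
  by apply/eqP; rewrite -complex_of_vec_eq0 -/w1 w10.
exists w1, (w2 / w1); split=> // [|i].
  apply/eqP => im0.
  have w2E : w2 = (complex.Re (w2 / w1))%:C%C * w1.
    by rewrite -[LHS](divfK w1_neq0); congr (_ * _); case: (w2 / w1) im0 => r s /= ->.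
  set r := complex.Re _ in w2E.
  suff /freeb/(_ 1)/eqP : \sum_(i < 2) (if i == 0 then r else -1) *: b`_i = 0.
    by rewrite /= oppr_eq0 oner_eq0.
  rewrite !big_ord_recl big_ord0 /= addr0 scaleN1r.
  apply/eqP; rewrite -complex_of_vec_eq0 raddfB /= complex_of_vecZ.
  by rewrite -[complex_of_vec b`_1]/w2 w2E subrr.
have : generated_group v (tnth v i).
  by rewrite generated_groupE; apply/asboolP/tnth_int_span.
rewrite generated_groupE vb => -[a vE]; exists (a 0), (a 1).
have {}vE : tnth v i = b`_0 *~ a 0 + b`_1 *~ a 1.
  rewrite vE !big_ord_recl big_ord0 addr0.
  by have -> : lift 0 0 = 1 :> 'I_2 by apply: val_inj.
rewrite complex_coordsE vE complex_of_vec_int_comb -/w1 -/w2.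
by rewrite mulrDr [w1 * (a 0)%:~R]mulrC mulrCA [w1 * _]mulrC divfK.
Qed.

End Lattices.

(** * Imaginary quadratic fields *)

Section ImaginaryQuadratic.
Variable R : realType.
Implicit Types (a z tau : R[i]).

Definition adjoinQ_pred a : {pred R[i]} := [pred z | `[< adjoinQ a z >]].

Fact adjoinQ_divring_closed a : divring_closed (adjoinQ_pred a).
Proof.
split=> [|x y /asboolP xa /asboolP ya|x y /asboolP xa /asboolP ya];
  apply/asboolP => S clS aS; have [S1 SB SV] := clS.
- exact: S1.
- exact: SB (xa _ clS aS) (ya _ clS aS).
- exact: SV (xa _ clS aS) (ya _ clS aS).
Qed.

HB.instance Definition _ a :=
  GRing.isDivringClosed.Build R[i] (adjoinQ_pred a) (adjoinQ_divring_closed a).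

Lemma adjoinQ_gen a : a \in adjoinQ_pred a.
Proof. by apply/asboolP => S. Qed.

(** The rational combinations of [1] and [a] already form a field, since
    [(p + q a)^-1 = (p - q a) / (p^2 + D q^2)]. *)
Lemma adjoinQ_sqrt (D : nat) a z : (0 < D)%N -> a ^+ 2 = - D%:R ->
  adjoinQ a z -> exists p q : rat, z = ratr p + ratr q * a.
Proof.
move=> D_gt0 aa za.
(* [adjoinQ] quantifies over boolean predicates. *)
apply/(asboolP (exists p q : rat, z = ratr p + ratr q * a)).
apply: (za [pred z | `[< exists p q : rat, z = ratr p + ratr q * a >]]).
  split=> [|x y /asboolP[p [q ->]] /asboolP[p' [q' ->]]
           |x y /asboolP[p [q ->]] /asboolP[p' [q' ->]]]; apply/asboolP.
  - by exists 1, 0; rewrite rmorph1 rmorph0 mul0r addr0.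
  - by exists (p - p'), (q - q'); rewrite !rmorphB /=; ring.
  have [->|y0] := eqVneq (ratr p' + ratr q' * a) 0.
    by exists 0, 0; rewrite invr0 mulr0 rmorph0 mul0r addr0.
  pose n := p' ^+ 2 + D%:R * q' ^+ 2.
  have n0 : n != 0.
    have Dq_ge0 : 0 <= D%:R * q' ^+ 2 by apply/mulr_ge0/sqr_ge0/ler0n.
    apply: contraNneq y0 => /eqP; rewrite (paddr_eq0 (sqr_ge0 _) Dq_ge0).
    rewrite [D%:R * _ == 0]mulf_eq0 pnatr_eq0 eqn0Ngt D_gt0 /= !sqrf_eq0 => /andP[/eqP -> /eqP ->].
    by rewrite rmorph0 mul0r addr0.
  have nE : ratr n = (ratr p' + ratr q' * a) * (ratr p' - ratr q' * a) :> R[i].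
    rewrite rmorphD rmorphM !rmorphXn rmorph_nat /=.
    have -> : D%:R = - a ^+ 2 :> R[i] by rewrite aa opprK.
    by ring.
  have n0' : ratr n != 0 :> R[i] by rewrite fmorph_eq0.
  exists ((p * p' + D%:R * (q * q')) / n), ((q * p' - p * q') / n).
  rewrite !fmorph_div /= rmorphD rmorphB !rmorphM rmorph_nat /=.
  have -> : D%:R = - a ^+ 2 :> R[i] by rewrite aa opprK.
  have y0' : ratr p' - ratr q' * a != 0.
    by apply: contraNneq n0' => y'0; rewrite nE y'0 mulr0.
  by rewrite nE; field; rewrite y0 y0'.
by apply/asboolP; exists 0, 1; rewrite rmorph0 rmorph1 mul1r add0r.
Qed.

Lemma squarefree_part (n : nat) : (0 < n)%N ->
  exists k D : nat, [/\ n = (k ^ 2 * D)%N, (0 < D)%N & squarefree D].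
Proof.
elim/ltn_ind: n => n IH n_gt0.
have [sqf|] := pselect (squarefree n); first by exists 1%N, n; rewrite mul1n.
move/existsNP => [m /not_implyP[/dvdnP[n' nE] /eqP m1]].
have := n_gt0; rewrite nE muln_gt0 expn_gt0 orbF => /andP[n'_gt0 m_gt0].
have [|k [D [n'E D_gt0 sqfD]]] := IH n' _ n'_gt0.
  by rewrite nE ltn_Pmulr // (ltn_exp2l 0) // ltn_neqAle eq_sym m1.
by exists (k * m)%N, D; split=> //; rewrite n'E expnMn mulnAC.
Qed.

(** Completing the square, [(C tau + B)^2] is the integer [B^2 - A C], which
    is negative since [C tau + B] is not real. *)
Lemma quadratic_adjoinQ (A B C : int) tau :
  C != 0 -> complex.Im tau != 0 ->
  A%:~R + B%:~R * tau *+ 2 + C%:~R * tau ^+ 2 = 0 ->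
  exists D : nat, [/\ (0 < D)%N, squarefree D &
    adjoinQ (sqrtC (- D%:R : R[i])) tau].
Proof.
move=> C0 im0 root.
have C0' : C%:~R != 0 :> R[i] by rewrite intr_eq0.
set y := C%:~R * tau + B%:~R.
have yy : y ^+ 2 = (B ^+ 2 - A * C)%:~R.
  transitivity (C%:~R * (A%:~R + B%:~R * tau *+ 2 + C%:~R * tau ^+ 2)
     + (B ^+ 2 - A * C)%:~R).
    by rewrite /y rmorphB rmorphXn rmorphM /=; ring.
  by rewrite root mulr0 add0r.
have imy : complex.Im y = C%:~R * complex.Im tau.
  have intE (m : int) : m%:~R = (m%:~R : R)%:C%C by rewrite rmorph_int.
  by rewrite /y !intE; case: (tau) => s t; simpc.
have [n nE] : exists n : nat, B ^+ 2 - A * C = - n%:Z.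
  case: (B ^+ 2 - A * C) yy => [n|n] yy; last by exists n.+1; rewrite NegzE.
  have yyR : y ^+ 2 = (Num.sqrt (n%:R : R))%:C%C ^+ 2.
    by rewrite yy -rmorphXn sqr_sqrtr ?ler0n //= rmorph_nat.
  have : complex.Im y = 0.
    by move/eqP: yyR; rewrite eqf_sqr => /orP[] /eqP -> /=; rewrite ?oppr0.
  move/eqP; rewrite imy mulf_eq0 intr_eq0 (negPf C0) /=.
  by rewrite (negPf im0).
have n_gt0 : (0 < n)%N.
  rewrite lt0n; apply/eqP => n0; move/eqP: yy; rewrite nE n0 oppr0 sqrf_eq0.
  move=> /eqP y0; move: imy; rewrite y0 => /esym/eqP.
  by rewrite mulf_eq0 intr_eq0 (negPf C0) (negPf im0).
have [k [D [nkD D_gt0 sqfD]]] := squarefree_part n_gt0.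
exists D; split=> //; set a := sqrtC _.
have aa : a ^+ 2 = - D%:R by rewrite sqrtCK.
have : y ^+ 2 = (k%:R * a) ^+ 2.
  by rewrite yy nE nkD exprMn aa mulrN rmorphN /= -natrX -natrM.
move/eqP; rewrite eqf_sqr => yka.
have yQ : y \in adjoinQ_pred a.
  by case/orP: yka => /eqP ->; rewrite ?rpredN rpredM ?rpred_nat ?adjoinQ_gen.
have -> : tau = (y - B%:~R) / C%:~R by rewrite /y addrK mulrC mulKf.
apply/asboolP; rewrite -[`[< _ >]]/(_ \in adjoinQ_pred a).
by rewrite rpred_div ?rpredB ?rpred_int.
Qed.

Lemma common_denominator (I : finType) (p : I -> rat) :
  exists2 k : int, k != 0 & exists m : I -> int,
    forall i, k%:~R * p i = (m i)%:~R.
Proof.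
exists (\prod_i denq (p i)).
  by apply/prodf_neq0 => i _; rewrite denq_neq0.
exists (fun i => numq (p i) * \prod_(j | j != i) denq (p j)) => i.
rewrite (bigD1 i) //= !rmorphM /= -[X in _ * X = _]divq_num_den.
by field; rewrite intr_eq0 denq_neq0.
Qed.

Lemma imag_quadratic_crystallographic (D N : nat) (v : N.-tuple 'cV[R]_2) :
  (0 < D)%N -> is_frame v ->
  (forall i, adjoinQ (sqrtC (- D%:R : R[i])) (complex_coords v 0 i)) ->
  crystallographic v.
Proof.
set a := sqrtC _ => D_gt0 spanv vQ.
have aa : a ^+ 2 = - D%:R by rewrite sqrtCK.
have /choice[p /choice[q vE]] : forall i, exists p q : rat,
    complex_coords v 0 i = ratr p + ratr q * a.
  by move=> i; exact: adjoinQ_sqrt D_gt0 aa (vQ i).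
have [k k0 [m mE]] := common_denominator p.
have [l l0 [n nE]] := common_denominator q.
have kC0 : k%:~R != 0 :> R[i] by rewrite intr_eq0.
have lC0 : l%:~R != 0 :> R[i] by rewrite intr_eq0.
have ratrE (r : rat) (s t : int) : s != 0 -> s%:~R * r = t%:~R ->
    ratr r = t%:~R / s%:~R :> R[i].
  move=> s0 st; rewrite -(ratr_int _ t) -st rmorphM /= ratr_int.
  by rewrite mulrC mulKf // intr_eq0.
pose e0 := vec_of_complex (k%:~R^-1 : R[i]); pose e1 := vec_of_complex (a / l%:~R).
apply: (frame_crystallographic (e := [tuple e0; e1])) => // i; apply/asboolP.
exists [ffun j => if j == 0 then m i else n i].
transitivity (e0 *~ m i + e1 *~ n i); last first.
  by rewrite !big_ord_recl big_ord0 !ffunE addr0.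
apply: (can_inj (@complex_of_vecK R)); rewrite -complex_coordsE vE.
rewrite complex_of_vec_int_comb !vec_of_complexK.
by rewrite (ratrE _ k (m i)) // (ratrE _ l (n i)) // mulrAC mulrA.
Qed.

End ImaginaryQuadratic.

(** * Crystallographic tight frames and imaginary quadratic points *)

Section FramesAndPoints.
Variables (R : realType) (N : nat).
Implicit Types (u v : N.-tuple 'cV[R]_2) (w : 'rV[R[i]]_N).
Local Notation CTF := (crystallographic_tight_frame R 2 N).

(** Dividing [sum z_i^2 = 0] by [w^2] gives [A + 2 B tau + C tau^2 = 0] with
    [A = sum m_i^2], [B = sum m_i n_i] and [C = sum n_i^2]. *)
Lemma frame_point v : CTF v ->
  (quadric R N `&` imag_quadratic_points R N) (hpoint (complex_coords v)).
Proof.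
case=> _ /tight_coords[z0 zz0] /crystallographic_coords[w [tau [w0 im0 zE]]].
have /choice[m /choice[n {}zE]] := zE.
split; first by exists (complex_coords v).
pose A := \sum_i m i ^+ 2; pose B := \sum_i m i * n i; pose C := \sum_i n i ^+ 2.
have root : A%:~R + B%:~R * tau *+ 2 + C%:~R * tau ^+ 2 = 0.
  have w20 : w ^+ 2 != 0 by rewrite expf_neq0.
  apply: (mulfI w20); rewrite mulr0 -zz0 /A /B /C !rmorph_sum /=.
  rewrite !mulr_suml -sumrMnl -!big_split mulr_sumr; apply: eq_bigr => i _ /=.
  by rewrite zE rmorphM !rmorphXn /=; ring.
(* [C = 0] forces all [n_i] to vanish, then [A = 0] by the equation, hence also
   all [m_i]: the point would have no nonzero coordinate. *)
have C0 : C != 0.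
  apply: contraNneq z0 => C0.
  have n0 i : n i = 0 by apply: sum_sqr_eq0 C0 i.
  have B0 : B = 0 by apply: big1 => i _; rewrite n0 mulr0.
  move: root; rewrite B0 C0 !mul0r mul0rn !addr0 => /eqP; rewrite intr_eq0 => /eqP A0.
  have m0 i : m i = 0 by apply: sum_sqr_eq0 A0 i.
  by apply/eqP/rowP => i; rewrite zE m0 n0 mul0r addr0 mulr0 mxE.
have [D [D_gt0 sqfD tauQ]] := quadratic_adjoinQ C0 im0 root.
exists D; first by split.
exists (w^-1 *: complex_coords v).
  split=> [|i]; first by rewrite scaler_eq0 invr_eq0 negb_or w0.
  have tauQ' : tau \in adjoinQ_pred (sqrtC (- D%:R)) by apply/asboolP.
  apply/asboolP; rewrite -[`[< _ >]]/(_ \in adjoinQ_pred _) mxE zE mulKf //.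
  by rewrite rpredD ?rpredM ?rpred_int.
apply/esym/(hpoint_eq _ z0); exists w => //.
by rewrite scalerA mulfV // scale1r.
Qed.

Lemma point_frame (D : nat) w : (0 < D)%N -> w != 0 ->
  \sum_i w 0 i ^+ 2 = 0 ->
  (forall i, adjoinQ (sqrtC (- D%:R : R[i])) (w 0 i)) ->
  CTF (vecs_of_coords w).
Proof.
move=> D_gt0 w0 ww0 wQ; set v := vecs_of_coords w.
have vw : complex_coords v = w := vecs_of_coordsK w.
have tv : tight v by apply: coords_tight; rewrite vw.
have fv := tight_is_frame tv; split=> //.
by apply: (imag_quadratic_crystallographic D_gt0 fv); rewrite vw.
Qed.

(** The coordinates [w] witnessing that [p] is over the field need not be the
    [z] witnessing that it is on the quadric, but they are proportional and the
    equation of the quadric is homogeneous. *)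
Lemma quadratic_point_frame (p : {vspace 'rV[R[i]]_N}) :
  (quadric R N `&` imag_quadratic_points R N) p ->
  exists2 v, CTF v & hpoint (complex_coords v) = p.
Proof.
case=> -[z [z0 zz0] <-] [D [D_gt0 _] [w [w0 wQ] wz]].
exists (vecs_of_coords w); last by rewrite vecs_of_coordsK.
apply: point_frame wQ => //; have [c _ ->] := (hpoint_eq _ w0).1 wz.
under eq_bigr => i _ do rewrite mxE exprMn.
by rewrite -mulr_sumr zz0 mulr0.
Qed.

Lemma similarity_class_mem v : CTF v -> similarity_class v v.
Proof. by move=> ?; split=> //; exact: oriented_similar_refl. Qed.

Lemma similarity_class_eq u v :
  oriented_similar u v -> similarity_class u = similarity_class v.
Proof.
move=> uv; apply/seteqP; split=> x [cx xs]; split=> //.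
  exact: oriented_similar_trans uv.
exact/(oriented_similar_trans xs)/oriented_similar_sym.
Qed.

Lemma hpoint_similar u v : CTF u ->
  hpoint (complex_coords u) = hpoint (complex_coords v) <-> oriented_similar u v.
Proof.
case=> _ /tight_coords[u0 _] _.
by rewrite oriented_similarP; exact: hpoint_eq.
Qed.

End FramesAndPoints.

Unset Implicit Arguments.
Set Strict Implicit.

Theorem theorem4p1 (R : realType) (N : nat) (hN : (2 < N)%N) :
  exists F : set (N.-tuple 'cV[R]_2) -> {vspace 'rV[R[i]]_N},
    (forall v : N.-tuple 'cV[R]_2, crystallographic_tight_frame R 2 N v ->
       F (similarity_class v) = hpoint (complex_coords v)) /\
    set_bij (similarity_classes R N)
      (quadric R N `&` imag_quadratic_points R N) F.
Proof.
(* Read the point off any member of the class; the default value of [xget] only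
   matters for empty sets, which are not classes. *)
pose F (X : set (N.-tuple 'cV[R]_2)) :=
  hpoint (complex_coords (xget (vecs_of_coords 0) X)).
have FE v : crystallographic_tight_frame R 2 N v ->
    F (similarity_class v) = hpoint (complex_coords v).
  move=> /similarity_class_mem vv.
  have [cu us] := xgetPex (vecs_of_coords 0) (ex_intro _ v vv).
  exact/hpoint_similar.
exists F; split=> //; split=> [_ [v cv <-]|X Y|p /quadratic_point_frame[v cv <-]].
- by rewrite FE //; exact: frame_point.
- rewrite !inE => -[u cu <-] [v cv <-]; rewrite !FE // => uv.
  exact/similarity_class_eq/hpoint_similar.
- by exists (similarity_class v); [exists v | exact: FE].
Qed.
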